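(* Let $A_0,A_1,\ldots,A_n\in M_N(\mathbb C)$ be Hermitian. Then $$\sup_{Z\prec0}\lambda_{\min}\Bigl(A_0+Z+\sum_{i=1}^n A_iZ^{-1}A_i\Bigr)=\min_{C\in\mathcal D_N}\Bigl\{\operatorname{Tr}(A_0C)-2\operatorname{Tr}\bigl(E_C^{1/2}\bigr)\Bigr\},$$ where the minimum on the right is attained.
   Context: $Z\prec0$ ranges over Hermitian negative definite matrices in $M_N(\mathbb C)$; $\lambda_{\min}$ is the smallest eigenvalue. $\mathcal D_N=\{C\in M_N(\mathbb C): C\succeq0,\ \operatorname{Tr}C=1\}$ is the set of density matrices. For $C\in\mathcal D_N$, $$E_C=C^{1/2}\Bigl(\sum_{i=1}^n A_iCA_i\Bigr)C^{1/2}=\sum_{i=1}^n(C^{1/2}A_iC^{1/2})^2,$$ and square roots are positive semidefinite square roots. *)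

(* Defs.v *)
From HB Require Import structures.
From mathcomp Require Import all_boot all_order all_algebra.
From mathcomp Require Import complex.
From mathcomp Require Import boolp classical_sets reals constructive_ereal ereal.

Set Implicit Arguments.
Unset Strict Implicit.
Unset Printing Implicit Defensive.

Import Order.TTheory GRing.Theory Num.Theory Num.Def.

Local Open Scope ring_scope.
Local Open Scope complex_scope.
Local Open Scope sesquilinear_scope.
Local Open Scope classical_set_scope.

(* The order on [R[i]] is partial: [0 <= z] means that [z] is real and
   nonnegative, and [z < 0] that it is real and negative. *)
Definition psdmx (R : realType) (N : nat) (M : 'M[R[i]]_N) : Prop :=
  M \is hermsymmx /\ forall x : 'cV[R[i]]_N, 0 <= (x^t* *m M *m x) 0 0.

Definition negdefmx (R : realType) (N : nat) (M : 'M[R[i]]_N) : Prop :=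
  M \is hermsymmx /\
  forall x : 'cV[R[i]]_N, x != 0 -> (x^t* *m M *m x) 0 0 < 0.

(* For [M] psd, [psd_sqrtmxP] and [psd_sqrtmx_uniq] below show that this is the
   unique psd matrix whose square is [M]. *)
Definition psd_sqrtmx (R : realType) (N : nat) (M : 'M[R[i]]_N) : 'M[R[i]]_N :=
  xget 0 [set B | psdmx B /\ B *m B = M].

(* For [M] Hermitian and [0 < N], the infimum is attained and bounds all complex
   eigenvalues from below: see [lambda_minP]. *)
Definition lambda_min (R : realType) (N : nat) (M : 'M[R[i]]_N) : R :=
  inf [set a : R | eigenvalue M a%:C].

Definition density (R : realType) (N : nat) (C : 'M[R[i]]_N) : Prop :=
  psdmx C /\ \tr C = 1.

Definition Emx (R : realType) (N n : nat) (A : 'I_n -> 'M[R[i]]_N)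
    (C : 'M[R[i]]_N) : 'M[R[i]]_N :=
  psd_sqrtmx C *m (\sum_(i < n) A i *m C *m A i) *m psd_sqrtmx C.

Definition primal_mx (R : realType) (N n : nat) (A0 : 'M[R[i]]_N)
    (A : 'I_n -> 'M[R[i]]_N) (Z : 'M[R[i]]_N) : 'M[R[i]]_N :=
  A0 + Z + \sum_(i < n) A i *m invmx Z *m A i.

Definition dual_obj (R : realType) (N n : nat) (A0 : 'M[R[i]]_N)
    (A : 'I_n -> 'M[R[i]]_N) (C : 'M[R[i]]_N) : R[i] :=
  \tr (A0 *m C) - 2 * \tr (psd_sqrtmx (Emx A C)).

Section WellDefined.
Variable R : realType.

Lemma hermsymmxP N (M : 'M[R[i]]_N) : reflect (M^t* = M) (M \is hermsymmx).
Proof.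
have <- : (M == (-1) ^+ false *: M^t*) = (M \is hermsymmx).
  by apply/eqP/is_hermitianmxP.
by rewrite expr0 scale1r eq_sym; apply: eqP.
Qed.

Lemma adjmxM m p q (X : 'M[R[i]]_(m, p)) (Y : 'M[R[i]]_(p, q)) :
  (X *m Y)^t* = Y^t* *m X^t*.
Proof. by rewrite trmx_mul map_mxM. Qed.

Lemma adjmx_mul_diag_ge0 p q (X : 'M[R[i]]_(p, q)) j : 0 <= (X^t* *m X) j j.
Proof.
by rewrite mxE sumr_ge0 // => k _; rewrite !mxE mulrC -normCK exprn_ge0.
Qed.

Lemma adjmx_mul_trace_ge0 p q (X : 'M[R[i]]_(p, q)) : 0 <= \tr (X^t* *m X).
Proof. by rewrite sumr_ge0 // => j _; apply: adjmx_mul_diag_ge0. Qed.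

Lemma adjmx_mul_trace_eq0 p q (X : 'M[R[i]]_(p, q)) :
  \tr (X^t* *m X) = 0 -> X = 0.
Proof.
move=> X0; apply/matrixP => i j; rewrite mxE.
have /(_ j isT) := psumr_eq0P (fun j _ => adjmx_mul_diag_ge0 X j) X0.
rewrite mxE => /psumr_eq0P /(_ i isT); rewrite !mxE mulrC -normCK.
have h (k : 'I_p) : true -> 0 <= X^t* j k * X k j.
  by rewrite !mxE mulrC -normCK exprn_ge0.
by move=> /(_ h) /eqP; rewrite expf_eq0 normr_eq0 => /eqP.
Qed.

Lemma psdmx_sqrt_ex N (M : 'M[R[i]]_N) :
  psdmx M -> exists B, psdmx B /\ B *m B = M.
Proof.
move=> [hM pM]; pose P := spectralmx M; pose d := spectral_diag M.
have PP : P *m P^t* = 1%:M by apply/unitarymxP/spectral_unitarymx.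
have PK k (Y : 'M[R[i]]_(k, N)) : Y *m P *m P^t* = Y.
  by rewrite -mulmxA PP mulmx1.
have ME : M = P^t* *m diag_mx d *m P.
  rewrite -invmx_unitary ?spectral_unitarymx //.
  exact/orthomx_spectralP/hermitian_normalmx.
have d_ge0 i : 0 <= d 0 i.
  have := pM (P^t* *m delta_mx i 0).
  rewrite adjmxM trmxCK {1}ME !mulmxA !PK trmx_delta map_delta_mx.
  by rewrite -mulmxA -colE -rowE !mxE eqxx.
pose S := diag_mx (map_mx sqrtC d).
pose T := diag_mx (map_mx (fun x => sqrtC (sqrtC x)) d).
have TT : T^t* *m T = S.
  rewrite tr_diag_mx map_diag_mx mulmx_diag; congr diag_mx.
  apply/rowP => i; rewrite !mxE mulrC -normCK ger0_norm ?sqrtC_ge0 //.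
  exact: sqrtCK.
have SS : S *m S = diag_mx d.
  rewrite mulmx_diag; congr diag_mx; apply/rowP => i.
  by rewrite !mxE -expr2 sqrtCK.
exists (P^t* *m S *m P); split; last first.
  by rewrite !mulmxA PK -(mulmxA _ S S) SS -ME.
have -> : P^t* *m S *m P = (T *m P)^t* *m (T *m P).
  by rewrite adjmxM -TT !mulmxA.
split; first by apply/hermsymmxP; rewrite adjmxM trmxCK.
move=> x; rewrite mulmxA -adjmxM -mulmxA; exact: adjmx_mul_diag_ge0.
Qed.

Lemma psdmx_sqrt_uniq N (B D : 'M[R[i]]_N) :
  psdmx B -> psdmx D -> B *m B = D *m D -> B = D.
Proof.
move=> pB pD BD; pose X := B - D.
have hX : X^t* = X.
  by rewrite linearB map_mxB /= !(hermsymmxP _ _) //; [case: pD|case: pB].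
have sandwich (S : 'M[R[i]]_N) :
    psdmx S -> exists2 T : 'M[R[i]]_N, X *m S *m X = (T *m X)^t* *m (T *m X)
    & T *m X = 0 -> S *m X = 0.
  move=> /psdmx_sqrt_ex [T [[/hermsymmxP hT _] <-]]; exists T.
    by rewrite adjmxM hT hX !mulmxA.
  by move=> TX; rewrite -mulmxA TX mulmx0.
have [T TE TX] := sandwich _ pB; have [U UE UX] := sandwich _ pD.
have : \tr (X *m B *m X) + \tr (X *m D *m X) = 0.
  rewrite (mxtrace_mulC (X *m D)) -(mulmxA X B X) -mxtraceD -mulmxDr.
  have -> : B *m X + X *m D = 0.
    by rewrite mulmxBr mulmxBl BD addrA subrK subrr.
  by rewrite mulmx0 mxtrace0.
rewrite TE UE => /eqP; rewrite paddr_eq0 ?adjmx_mul_trace_ge0 //.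
move=> /andP[/eqP/adjmx_mul_trace_eq0/TX BX0 /eqP/adjmx_mul_trace_eq0/UX DX0].
apply/eqP; rewrite -subr_eq0; apply/eqP/adjmx_mul_trace_eq0.
by rewrite -/X hX {1}/X mulmxBl BX0 DX0 subr0 mxtrace0.
Qed.

Lemma psd_sqrtmxP N (M : 'M[R[i]]_N) :
  psdmx M -> psdmx (psd_sqrtmx M) /\ psd_sqrtmx M *m psd_sqrtmx M = M.
Proof. by move=> /psdmx_sqrt_ex /(xgetPex 0). Qed.

Lemma psd_sqrtmx_uniq N (M B : 'M[R[i]]_N) :
  psdmx M -> psdmx B -> B *m B = M -> B = psd_sqrtmx M.
Proof.
move=> /psd_sqrtmxP[pS SS] pB BB; apply: psdmx_sqrt_uniq => //.
by rewrite BB SS.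
Qed.

Lemma hermsymmx_eigenvalue_real N (M : 'M[R[i]]_N) (a : R[i]) :
  M \is hermsymmx -> eigenvalue M a -> a = (complex.Re a)%:C.
Proof.
move=> /hermsymmxP hM /eigenvalueP[v vM v0]; apply/esym/eqP.
have vv0 : \tr (v^t*^t* *m v^t*) != 0.
  apply: contra v0 => /eqP/adjmx_mul_trace_eq0 vt0.
  by rewrite -(trmxCK v) vt0 trmx0 map_mx0.
have /(mulIf vv0) : a * \tr (v^t*^t* *m v^t*) = a^* * \tr (v^t*^t* *m v^t*).
  have e1 : v *m M *m v^t* = a *: (v *m v^t*) by rewrite vM scalemxAl.
  have e2 : v *m M *m v^t* = a^* *: (v *m v^t*).
    by rewrite -mulmxA -{1}hM -adjmxM vM linearZ map_mxZ /= -scalemxAr.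
  by rewrite trmxCK -!mxtraceZ -e1 e2.
case: a {vM} => x y /= [] /eqP; rewrite -addr_eq0 -mulr2n mulrn_eq0 /=.
by move=> /eqP ->.
Qed.

Lemma seq_min (s : seq R) : s != [::] ->
  exists2 m, m \in s & forall a, a \in s -> m <= a.
Proof.
elim: s => // x [|y s] IH _.
  by exists x; rewrite ?mem_head // => a; rewrite inE => /eqP ->.
have [m ms mle] := IH isT; have [xm|mx] := leP x m.
  exists x; rewrite ?mem_head // => a; rewrite inE => /orP[/eqP-> //|/mle].
  exact: le_trans.
exists m; first by rewrite inE ms orbT.
by move=> a; rewrite inE => /orP[/eqP->|/mle //]; apply: ltW.
Qed.

Lemma lambda_minP N (M : 'M[R[i]]_N) : (0 < N)%N -> M \is hermsymmx ->
  eigenvalue M (lambda_min M)%:C /\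
  forall a : R[i], eigenvalue M a -> (lambda_min M)%:C <= a.
Proof.
move=> N0 hM; have [rs rsE] := closed_field_poly_normal (char_poly M).
have evE a : eigenvalue M a = (a \in rs).
  rewrite eigenvalue_root_char rsE (monicP (char_poly_monic M)) scale1r.
  exact: root_prod_XsubC.
have [a0 ea0] := eigenvalue_closed M N0.
have [|m ms mle] := @seq_min (map (@complex.Re R) rs).
  by apply: contraTN ea0 => /eqP; rewrite evE; case: (rs).
have em : eigenvalue M m%:C.
  move: ms => /mapP[z zrs ->]; rewrite -(hermsymmx_eigenvalue_real hM) evE //.
have lb : lbound [set a : R | eigenvalue M a%:C] m.
  by move=> a /=; rewrite evE => ars; apply: mle; apply/mapP; exists a%:C.
have -> : lambda_min M = m.
  apply/le_anti/andP; split; first by apply: ge_inf => //; exists m.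
  by apply: lb_le_inf => //; exists m.
split=> // a ea; rewrite (hermsymmx_eigenvalue_real hM ea) lecR.
by apply: mle; rewrite map_f // -evE.
Qed.

Lemma Emx_sum_sqr N n (A : 'I_n -> 'M[R[i]]_N) (C : 'M[R[i]]_N) : psdmx C ->
  Emx A C = \sum_(i < n) (psd_sqrtmx C *m A i *m psd_sqrtmx C)
                      *m (psd_sqrtmx C *m A i *m psd_sqrtmx C).
Proof.
move=> /psd_sqrtmxP[_ SS]; rewrite /Emx mulmx_sumr mulmx_suml.
by apply: eq_bigr => i _; rewrite -{2}SS !mulmxA.
Qed.

Lemma Emx_psd N n (A : 'I_n -> 'M[R[i]]_N) (C : 'M[R[i]]_N) :
  (forall i, A i \is hermsymmx) -> psdmx C -> psdmx (Emx A C).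
Proof.
move=> hA pC; have [[/hermsymmxP hS _] _] := psd_sqrtmxP pC.
rewrite Emx_sum_sqr //; set S := psd_sqrtmx C in hS *.
have hW i : (S *m A i *m S)^t* = S *m A i *m S.
  by rewrite !adjmxM hS (hermsymmxP _ (hA i)) mulmxA.
split.
  apply/hermsymmxP; rewrite raddf_sum /= map_mx_sum; apply: eq_bigr => i _.
  by rewrite adjmxM hW.
move=> x; rewrite mulmx_sumr mulmx_suml summxE sumr_ge0 // => i _.
move: (S *m A i *m S) (hW i) => W hWi.
by rewrite -{1}hWi mulmxA -adjmxM -mulmxA adjmx_mul_diag_ge0.
Qed.

End WellDefined.

(* Main.v *)
Require Import Defs.
From mathcomp Require Import all_boot all_order all_algebra.
From mathcomp Require Import complex ring lra.
From mathcomp Require Import boolp classical_sets reals constructive_ereal ereal.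

(* Write [Phi Z] for the primal matrix and [s] for the supremum of its smallest
   eigenvalue, and put [W = - Z], [B = \sum_i A_i C A_i]. For a density matrix
   [C], [tr (C (Phi Z)) = tr (A0 C) - (tr (C W) + tr (W^-1 B))], and the infimum
   over positive definite [W] of the last bracket is [2 tr (E_C ^ (1/2))]: the
   lower bound completes a square, the upper bound inserts a regularization of
   the formal minimizer. Hence the dual objective at [C] is the supremum over
   [Z] of [tr (C (Phi Z))], which gives weak duality. Conversely, [Phi] is
   operator concave, so the Hermitian matrices below some [t (Phi Z - s)],
   [0 <= t], form a convex cone, which contains no positive definite matrix by
   the choice of [s]. A finite-dimensional Hahn-Banach argument yields a density
   matrix [C] with [tr (C X) <= 0] on this cone, so the dual objective at [C] is
   at most [s]: it is a minimizer. *)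

Import Order.TTheory GRing.Theory Num.Theory.
Local Open Scope ring_scope.
Local Open Scope complex_scope.
Local Open Scope sesquilinear_scope.
Local Open Scope classical_set_scope.

Set Implicit Arguments.
Unset Strict Implicit.

(** * Positive semidefinite matrices *)

Section PositiveMatrices.
Variable R : realType.
Implicit Types (N p q : nat) (a : R[i]).

Lemma adjmxD p q (X Y : 'M[R[i]]_(p, q)) : (X + Y)^t* = X^t* + Y^t*.
Proof. by rewrite linearD map_mxD. Qed.

Lemma adjmxZ p q a (X : 'M[R[i]]_(p, q)) : (a *: X)^t* = a^*%R *: X^t*.
Proof. by rewrite linearZ map_mxZ. Qed.

Lemma adjmx_scalar N a : (a%:M : 'M[R[i]]_N)^t* = (a^*%R)%:M.
Proof. by rewrite tr_scalar_mx map_scalar_mx. Qed.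

Lemma adjmx_tr N (M : 'M[R[i]]_N) : \tr (M^t*) = (\tr M)^*%R.
Proof.
rewrite /mxtrace raddf_sum; apply: eq_bigr => i _; by rewrite !mxE.
Qed.

Lemma conjC_real (a : R) : (a%:C)^*%R = a%:C :> R[i].
Proof. by rewrite /Num.conj /= oppr0. Qed.

Lemma psdmx_adj N (M : 'M[R[i]]_N) : psdmx M -> M^t* = M.
Proof. by case=> /hermsymmxP. Qed.

Lemma psdmx_congr N p (M : 'M[R[i]]_N) (X : 'M[R[i]]_(N, p)) :
  psdmx M -> psdmx (X^t* *m M *m X).
Proof.
move=> [/hermsymmxP hM pM]; split.
  by apply/hermsymmxP; rewrite !adjmxM hM trmxCK mulmxA.
move=> x; have := pM (X *m x); by rewrite adjmxM !mulmxA.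
Qed.

Lemma psdmx1 N : psdmx (1%:M : 'M[R[i]]_N).
Proof.
split; first by apply/hermsymmxP; rewrite adjmx_scalar conjC1.
by move=> x; rewrite mulmx1 adjmx_mul_diag_ge0.
Qed.

Lemma psdmxD N (M P : 'M[R[i]]_N) : psdmx M -> psdmx P -> psdmx (M + P).
Proof.
move=> [/hermsymmxP hM pM] [/hermsymmxP hP pP]; split.
  by apply/hermsymmxP; rewrite adjmxD hM hP.
by move=> x; rewrite mulmxDr mulmxDl mxE addr_ge0.
Qed.

Lemma psdmxZ N a (M : 'M[R[i]]_N) : 0 <= a -> psdmx M -> psdmx (a *: M).
Proof.
move=> a0 [/hermsymmxP hM pM]; split.
  by apply/hermsymmxP; rewrite adjmxZ hM geC0_conj.
by move=> x; rewrite -scalemxAr -scalemxAl mxE mulr_ge0.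
Qed.

Lemma psdmx_scalar N a : 0 <= a -> psdmx (a%:M : 'M[R[i]]_N).
Proof. by move=> a0; rewrite -scalemx1; apply/psdmxZ/psdmx1. Qed.

Lemma psdmx0 N : psdmx (0 : 'M[R[i]]_N).
Proof. by rewrite -(scale0r 1%:M); apply/psdmxZ/psdmx1. Qed.

Lemma psdmx_sum N (I : finType) (F : I -> 'M[R[i]]_N) :
  (forall i, psdmx (F i)) -> psdmx (\sum_i F i).
Proof.
by move=> pF; elim/big_ind: _ => [|M P|i _]; [apply: psdmx0|apply: psdmxD|].
Qed.

Lemma psdmx_tr_ge0 N (M : 'M[R[i]]_N) : psdmx M -> 0 <= \tr M.
Proof.
move=> /[dup] /psdmx_adj hM /psdmx_sqrt_ex[B [/psdmx_adj hB <-]].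
by rewrite -{1}hB adjmx_mul_trace_ge0.
Qed.

(** With [M = B^2], cyclicity makes this the trace of the congruence [B P B]. *)
Lemma psdmx_tr_mul_ge0 N (M P : 'M[R[i]]_N) :
  psdmx M -> psdmx P -> 0 <= \tr (M *m P).
Proof.
move=> /psdmx_sqrt_ex[B [pB <-]] pP.
have := psdmx_tr_ge0 (psdmx_congr B pP).
by rewrite (psdmx_adj pB) mxtrace_mulC mulmxA.
Qed.

(** Invertibility replaces strict positivity of the form, so that inverses are at hand; [posdefmxP]
    shows that the two agree. *)
Definition posdefmx N (M : 'M[R[i]]_N) := psdmx M /\ M \in unitmx.

Lemma posdefmxP N (M : 'M[R[i]]_N) : posdefmx M <->
  M^t* = M /\ forall x : 'cV_N, x != 0 -> 0 < (x^t* *m M *m x) 0 0.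
Proof.
split=> [[pM uM]|[hM pM]].
  split=> [|x x0]; first exact: psdmx_adj.
  rewrite lt_neqAle (proj2 pM) andbT; apply: contra x0 => /eqP/esym.
  (* The form at [x] is the squared norm of [B x]; if it vanishes, so does [M x], hence [x]. *)
  have [B [pB BB]] := psdmx_sqrt_ex pM.
  rewrite -BB mulmxA -{1}(psdmx_adj pB) -adjmxM -mulmxA -trace_mx11.
  move=> /adjmx_mul_trace_eq0 Bx0.
  by rewrite -(mulKmx uM x) -BB -mulmxA Bx0 !mulmx0.
split.
  split=> [|x]; first exact/hermsymmxP.
  by have [->|/pM/ltW//] := eqVneq x 0; rewrite mulmx0 mxE.
rewrite -row_free_unit -kermx_eq0; apply/negPn/negP => /rowV0Pn[v].
move=> /sub_kermxP vM v0; have /pM : v^t* != 0.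
  by apply: contra v0 => /eqP vt; rewrite -(trmxCK v) vt trmx0 map_mx0.
by rewrite trmxCK vM mul0mx mxE ltxx.
Qed.

Lemma negdefmxE N (Z : 'M[R[i]]_N) : negdefmx Z <-> posdefmx (- Z).
Proof.
rewrite posdefmxP /negdefmx; split=> -[/= hZ nZ]; split.
- by rewrite linearN map_mxN (hermsymmxP _ hZ).
- by move=> x /nZ x0; rewrite mulmxN mulNmx mxE oppr_gt0.
- by apply/hermsymmxP/oppr_inj; rewrite -map_mxN -linearN.
- by move=> x /nZ; rewrite mulmxN mulNmx [X in 0 < X]mxE oppr_gt0.
Qed.

Lemma posdefmxDl N (M P : 'M[R[i]]_N) :
  posdefmx M -> psdmx P -> posdefmx (M + P).
Proof.
move=> /posdefmxP[hM pM] [/hermsymmxP hP pP]; apply/posdefmxP; split.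
  by rewrite adjmxD hM hP.
by move=> x /pM x0; rewrite mulmxDr mulmxDl mxE ltr_wpDr.
Qed.

Lemma posdefmxZ N a (M : 'M[R[i]]_N) :
  0 < a -> posdefmx M -> posdefmx (a *: M).
Proof.
move=> a0 [pM uM]; split; first by apply: psdmxZ => //; apply: ltW.
by rewrite unitmxZ // unitfE gt_eqF.
Qed.

Lemma posdefmx_scalar N a : 0 < a -> posdefmx (a%:M : 'M[R[i]]_N).
Proof.
move=> a0; rewrite -scalemx1; apply: posdefmxZ => //; split.
  exact: psdmx1.
exact: unitmx1.
Qed.

Lemma adjmx_inv N (M : 'M[R[i]]_N) : (invmx M)^t* = invmx (M^t*).
Proof. by rewrite trmx_inv map_invmx. Qed.

(** [M^-1] is the congruence of [M] by [M^-1]. *)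
Lemma psdmx_inv N (M : 'M[R[i]]_N) : posdefmx M -> psdmx (invmx M).
Proof.
move=> [pM uM]; have := psdmx_congr (invmx M) pM.
by rewrite adjmx_inv (psdmx_adj pM) (mulVmx uM) mul1mx.
Qed.

Lemma posdefmx_congr N (M X : 'M[R[i]]_N) :
  posdefmx M -> X \in unitmx -> posdefmx (X^t* *m M *m X).
Proof.
move=> [pM uM] uX; split; first exact: psdmx_congr.
rewrite !unitmx_mul uM uX !andbT.
by rewrite map_unitmx unitmx_tr.
Qed.

(* With [J = (a M + b P)^-1], the gap is
   [a (M^-1 - J) M (M^-1 - J) + b (P^-1 - J) P (P^-1 - J)]. *)
Lemma psdmx_inv_convex N a b (M P : 'M[R[i]]_N) :
  0 < a -> 0 < b -> a + b = 1 -> posdefmx M -> posdefmx P ->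
  psdmx (a *: invmx M + b *: invmx P - invmx (a *: M + b *: P)).
Proof.
move=> a0 b0 ab pM pP; set J := invmx (_ + _).
have pJ : posdefmx (a *: M + b *: P).
  by apply: posdefmxDl; [apply: posdefmxZ|apply/psdmxZ/pP.1; apply: ltW].
have JV : J *m (a *: M + b *: P) = 1%:M := mulVmx pJ.2.
have gap Q : posdefmx Q -> psdmx (invmx Q - J *+ 2 + J *m Q *m J).
  move=> pQ; have := psdmx_congr (invmx Q - J) pQ.1; congr psdmx.
  rewrite adjmxD linearN map_mxN /= psdmx_adj; last exact: psdmx_inv.
  rewrite psdmx_adj; last exact: psdmx_inv.
  rewrite mulmxBl mulmxBr mulVmx ?pQ.2 // !mulmxBl mul1mx mul1mx.
  by rewrite -mulmxA mulmxV ?pQ.2 // mulmx1 opprB mulr2n opprD !addrA addrAC.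
have := psdmxD (psdmxZ (ltW a0) (gap _ pM)) (psdmxZ (ltW b0) (gap _ pP)).
congr psdmx; rewrite !scalerDr [X in X = _]addrACA.
have -> : a *: (J *m M *m J) + b *: (J *m P *m J) = J.
  rewrite !(scalemxAl _ (_ *m _)) !scalemxAr -mulmxDl -mulmxDr.
  by rewrite JV mul1mx.
rewrite addrACA -addrA; congr (_ + _).
rewrite -scalerDl ab scale1r mulr2n opprD.
by rewrite subrK.
Qed.

End PositiveMatrices.

(** * Linear minorants of sublinear functionals *)

Section Sublinear.
Variables (R : realType) (V : lmodType R[i]).
Implicit Types (p q : V -> R) (x y e : V) (a b t : R).

(** Only real scalars enter, so [V] is treated as a real vector space. The inequality for positive
    scalars already forces equality, see [sublinearZ]. *)
Definition sublinear p :=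
  (forall x y, p (x + y) <= p x + p y) /\
  (forall a x, 0 < a -> p (a%:C *: x) <= a * p x).

Lemma sublinearZ p a x : sublinear p -> 0 < a -> p (a%:C *: x) = a * p x.
Proof.
move=> [_ pZ] a0; apply/le_anti; rewrite pZ //= -ler_pdivlMl //.
have := pZ a^-1 (a%:C *: x); rewrite invr_gt0 => /(_ a0).
by rewrite scalerA -rmorphM mulVf ?gt_eqF //= scale1r.
Qed.

Lemma sublinear0 p : sublinear p -> p 0 = 0.
Proof.
move=> sp; have := sublinearZ 0 sp (@ltr0Sn R 1).
by rewrite scaler0 => h; lra.
Qed.

(** This is the lower envelope of a convex cone of pairs [(x, a)]. The condition at [0] keeps the
    infima finite: any value at [- x] bounds the values at [x] from below. *)
Lemma sublinear_inf (G : V -> R -> Prop) :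
    (forall x y a b, G x a -> G y b -> G (x + y) (a + b)) ->
    (forall c x a, 0 < c -> G x a -> G (c%:C *: x) (c * a)) ->
    (forall x, exists a, G x a) ->
    (forall a, G 0 a -> 0 <= a) ->
  (forall x a, G x a -> inf [set b | G x b] <= a) /\
  sublinear (fun x => inf [set b | G x b]).
Proof.
move=> GD GZ Gex G0.
have Gle x a : G x a -> inf [set b | G x b] <= a.
  have [b Gb] := Gex (- x).
  move=> Ga; apply: ge_inf => //; exists (- b) => c /= Gc.
  by rewrite -subr_ge0 opprK; apply: G0; rewrite -(subrr x); apply: GD.
split=> //; split=> [x y|c x c0].
  rewrite -lerBlDr; apply: lb_le_inf => [|a /= Ga]; first exact: Gex.
  rewrite lerBlDr -lerBlDl; apply: lb_le_inf => [|b /= Gb]; first exact: Gex.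
  by rewrite lerBlDl; apply/Gle/GD.
rewrite -ler_pdivrMl //; apply: lb_le_inf => [|a /= Ga]; first exact: Gex.
by rewrite ler_pdivrMl //; apply/Gle/GZ.
Qed.

(* Take [q x = inf_(t >= 0) (p (x + t e) - t p e)]; any sublinear functional
   below [q] is still additive along [e], so the step can be iterated. *)
Lemma sublinear_odd_at p e : sublinear p ->
  exists q, [/\ sublinear q, forall x, q x <= p x & q e + q (- e) <= 0].
Proof.
move=> sp; have [pD pZ] := sp.
pose G x a := exists2 t, 0 <= t & a = p (x + t%:C *: e) - t * p e.
have pZ0 t x : 0 <= t -> p (t%:C *: x) = t * p x.
  rewrite le0r => /orP[/eqP->|]; last exact: sublinearZ.
  by rewrite scale0r mul0r sublinear0.
have GD x y a b : G x a -> G y b -> exists2 c, G (x + y) c & c <= a + b.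
  move=> [t t0 ->] [u u0 ->]; exists (p (x + y + (t + u)%:C *: e) - (t + u) * p e).
    by exists (t + u); rewrite ?addr_ge0.
  rewrite rmorphD scalerDl addrACA /=.
  have := pD (x + t%:C *: e) (y + u%:C *: e); lra.
(* [G] is additive only up to an inequality; its upward closure [H] is additive and has the same
   infima. *)
pose H x a := exists2 b, G x b & b <= a.
have [||||Hle sH] := @sublinear_inf H.
- move=> x y a b [c Gc ca] [d Gd db]; have [f Gf fcd] := GD _ _ _ _ Gc Gd.
  by exists f => //; apply: (le_trans fcd); apply: lerD.
- move=> c x a c0 [b [t t0 bE] ba]; exists (c * b); last by rewrite ler_pM2l.
  exists (c * t); first by rewrite mulr_ge0 // ltW.
  rewrite rmorphM -scalerA -scalerDr /= sublinearZ // bE; ring.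
- move=> x; exists (p x); exists (p x) => //; exists 0 => //.
  by rewrite scale0r addr0 mul0r subr0.
- move=> a [b [t t0 ->]]; rewrite add0r pZ0 // subrr //.
set q := (X in sublinear X) in sH.
have qp x : q x <= p x.
  apply: Hle; exists (p x) => //; exists 0 => //.
  by rewrite scale0r addr0 mul0r subr0.
exists q; split=> //.
(* The choice [t = 1] gives the value [p 0 - p e]. *)
have : q (- e) <= - p e.
  apply: Hle; exists (- p e) => //; exists 1 => //.
  by rewrite scale1r addNr sublinear0 // mul1r sub0r.
have := qp e; lra.
Qed.

Lemma sublinear_odd_seq p (s : seq V) : sublinear p ->
  exists q, [/\ sublinear q, forall x, q x <= p x
    & forall e, e \in s -> q e + q (- e) <= 0].
Proof.
elim: s p => [|e s IH] p sp; first by exists p.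
have [r [sr rp re]] := sublinear_odd_at e sp.
have [q [sq qr qs]] := IH _ sr; exists q; split=> // [x|x].
  exact: le_trans (qr x) (rp x).
rewrite inE => /orP[/eqP->|/qs//].
by apply: le_trans re; apply: lerD.
Qed.

(** Subadditivity gives [0 <= p z + p (- z)], so the hypotheses say that [p] is odd at [x] and [y].
    Subadditivity at [- x] and [- y] then reverses the inequality at [x] and [y]. *)
Lemma sublinear_oddD p x y : sublinear p ->
  p x + p (- x) <= 0 -> p y + p (- y) <= 0 ->
  p (x + y) = p x + p y /\ p (x + y) + p (- (x + y)) <= 0.
Proof.
move=> sp; have [pD _] := sp; have p0 := sublinear0 sp.
have odd z : 0 <= p z + p (- z) by rewrite -p0 -(subrr z).
have := pD x y; have := pD (- x) (- y); rewrite -opprD.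
have := odd (x + y); have := odd x; have := odd y.
move=> *; split; lra.
Qed.

Lemma sublinear_oddZ p a x : sublinear p -> p x + p (- x) <= 0 ->
  p (a%:C *: x) = a * p x.
Proof.
move=> sp px; have p0 := sublinear0 sp.
have pN : p (- x) = - p x.
  by apply/eqP; rewrite -addr_eq0 addrC eq_le px -p0 -{1}(subrr x) sp.1.
have [a0|a0|->] := ltgtP a 0; last by rewrite scale0r mul0r.
  rewrite -{1}(opprK a) rmorphN scaleNr -scalerN.
  by rewrite sublinearZ ?oppr_gt0 // pN mulrNN.
exact: sublinearZ.
Qed.

End Sublinear.

(** * Smallest eigenvalue and separation *)

Section LambdaMin.
Variable R : realType.
Implicit Types (N : nat).

(** In the spectral decomposition, the entries of [d] are eigenvalues with the rows of the unitary
    [P] as eigenvectors, so [M] is a congruence of a nonnegative diagonal matrix. *)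
Lemma hermsymmx_psd N (M : 'M[R[i]]_N) : M \is hermsymmx ->
  (forall a, eigenvalue M a -> 0 <= a) -> psdmx M.
Proof.
move=> hM pM; pose P := spectralmx M; pose d := spectral_diag M.
have PP : P *m P^t* = 1%:M by apply/unitarymxP/spectral_unitarymx.
have ME : M = P^t* *m diag_mx d *m P.
  rewrite -invmx_unitary ?spectral_unitarymx //.
  exact/orthomx_spectralP/hermitian_normalmx.
have d0 i : 0 <= d 0 i.
  apply: pM; apply/eigenvalueP; exists (row i P).
    rewrite {1}ME !mulmxA -row_mul PP row1 -rowE row_diag_mx -scalemxAl.
    by rewrite -rowE.
  apply/negP => /eqP P0; have : row i P *m P^t* = 0 by rewrite P0 mul0mx.
  rewrite -row_mul PP => /rowP/(_ i); rewrite !mxE eqxx => /eqP.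
  by rewrite oner_eq0.
rewrite ME; apply: psdmx_congr.
split=> [|x]; first apply/hermsymmxP.
  rewrite tr_diag_mx map_diag_mx; congr diag_mx; apply/rowP => i.
  by rewrite !mxE; apply: geC0_conj.
rewrite mxE sumr_ge0 // => i _; rewrite mul_mx_diag !mxE.
by rewrite mulrAC mulr_ge0 // mulrC -normCK exprn_ge0.
Qed.

Lemma hermsymmx_real_scalar N (a : R) : (a%:C%:M : 'M[R[i]]_N) \is hermsymmx.
Proof. by apply/hermsymmxP; rewrite adjmx_scalar conjC_real. Qed.

Lemma hermsymmxD N (M P : 'M[R[i]]_N) :
  M \is hermsymmx -> P \is hermsymmx -> M + P \is hermsymmx.
Proof.
move=> /hermsymmxP hM /hermsymmxP hP.
by apply/hermsymmxP; rewrite adjmxD hM hP.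
Qed.

Lemma hermsymmxN N (M : 'M[R[i]]_N) : M \is hermsymmx -> - M \is hermsymmx.
Proof.
by move=> /hermsymmxP hM; apply/hermsymmxP; rewrite linearN map_mxN /= hM.
Qed.

(** The shift moves every eigenvalue down by the smallest one. Together with [le_lambda_min], this
    translates bounds on [lambda_min] into the matrix order. *)
Lemma psdmx_lambda_min N (M : 'M[R[i]]_N) : (0 < N)%N -> M \is hermsymmx ->
  psdmx (M - (lambda_min M)%:C%:M).
Proof.
move=> N0 hM; have [_ lmin] := lambda_minP N0 hM.
apply: hermsymmx_psd => [|a /eigenvalueP[v vM v0]].
  exact/hermsymmxD/hermsymmxN/hermsymmx_real_scalar.
have /lmin : eigenvalue M (a + (lambda_min M)%:C).
  apply/eigenvalueP; exists v => //.
  rewrite scalerDl -vM mulmxBr -!mul_mx_scalar.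
  by rewrite subrK.
by rewrite lerDr.
Qed.

(** Evaluate the form at an eigenvector for [lambda_min M]. *)
Lemma le_lambda_min N (M : 'M[R[i]]_N) (a : R) : (0 < N)%N ->
  psdmx (M - a%:C%:M) -> a <= lambda_min M.
Proof.
move=> N0 pM; have hM : M \is hermsymmx.
  by rewrite -(subrK a%:C%:M M); apply/hermsymmxD/hermsymmx_real_scalar/pM.1.
have [/eigenvalueP[v vM v0] _] := lambda_minP N0 hM.
have vv0 : 0 < (v *m v^t*) 0 0.
  have [_ pos1] := (posdefmxP (1%:M : 'M[R[i]]_N)).1 (posdefmx_scalar _ ltr01).
  have := pos1 (v^t*); rewrite trmxCK mulmx1; apply.
  by apply: contra v0 => /eqP vt; rewrite -(trmxCK v) vt trmx0 map_mx0.
have := pM.2 (v^t*); rewrite trmxCK mulmxBr vM mul_mx_scalar -scalerBl.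
by rewrite -scalemxAl mxE pmulr_lge0 // -rmorphB lecE /= eqxx subr_ge0.
Qed.

(* [inf {c | c + Y >= herm X for some Y in K}] is sublinear in [X]; a real-linear
   functional below it, restricted to Hermitian matrices, is [tr (C X)]. *)
Lemma density_separation N (K : set 'M[R[i]]_N) : (0 < N)%N ->
    K 0 -> (forall X Y, K X -> K Y -> K (X + Y)) ->
    (forall (c : R) X, 0 < c -> K X -> K (c%:C *: X)) ->
    (forall X, K X -> X \is hermsymmx) ->
    (forall X (c : R), K X -> psdmx (X - c%:C%:M) -> c <= 0) ->
  exists2 C : 'M[R[i]]_N, density C & forall X, K X -> \tr (C *m X) <= 0.
Proof.
move=> N0 K0 KD KZ Kherm Knpd.
pose half : R := 2^-1.
(* The projection onto Hermitian matrices lets the functional be defined on the whole matrix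
   space. *)
pose herm X : 'M[R[i]]_N := half%:C *: (X + X^t*).
have hermD X Y : herm (X + Y) = herm X + herm Y.
  by rewrite /herm adjmxD addrACA scalerDr.
have hermZ (c : R) X : herm (c%:C *: X) = c%:C *: herm X.
  by rewrite /herm adjmxZ conjC_real -scalerDr !scalerA mulrC.
have halfD (X : 'M[R[i]]_N) : half%:C *: (X + X) = X.
  rewrite scalerDr -scalerDl -rmorphD -mulr2n -mulr_natl mulfV ?pnatr_eq0 //.
  by rewrite scale1r.
have herm_id X : X \is hermsymmx -> herm X = X.
  by move=> /hermsymmxP hX; rewrite /herm hX halfD.
have herm_herm X : herm X \is hermsymmx.
  by apply/hermsymmxP; rewrite adjmxZ conjC_real adjmxD trmxCK addrC.
pose G X (c : R) := exists2 Y, K Y & psdmx (c%:C%:M + Y - herm X).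
have [|||| Gle spG] := @sublinear_inf R 'M[R[i]]_N G.
- move=> X Y a b [X' KX' pX] [Y' KY' pY]; exists (X' + Y'); first exact: KD.
  have := psdmxD pX pY; congr psdmx.
  by rewrite addrACA -opprD -hermD addrACA -!raddfD.
- move=> c X a c0 [Y KY pY]; exists (c%:C *: Y); first exact: KZ.
  have := @psdmxZ _ _ c%:C _ _ pY; rewrite lecR => /(_ (ltW c0)); congr psdmx.
  by rewrite hermZ scalerBr scalerDr scale_scalar_mx -rmorphM.
(* This is the largest eigenvalue of [herm X], so [Y = 0] serves. *)
- move=> X; exists (- lambda_min (- herm X)); exists 0 => //.
  have := psdmx_lambda_min N0 (hermsymmxN (herm_herm X)); congr psdmx.
  by rewrite addr0 addrC !rmorphN /= raddfN.
(* Here [Y - (- a)] is psd with [Y] in [K], so [Knpd] gives [- a <= 0]. *)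
- move=> a [Y KY]; have -> : herm 0 = 0.
    by rewrite -{1}(scale0r 0) -[0 in LHS](rmorph0 (real_complex R)) hermZ scale0r.
  rewrite subr0 => pY; rewrite -oppr_le0; apply: Knpd KY _.
  by rewrite rmorphN raddfN opprK addrC.
(* These matrices span over the reals, so oddness on them makes [q] real-linear. *)
pose basis : seq 'M[R[i]]_N := [seq delta_mx ij.1 ij.2 | ij : 'I_N * 'I_N]
  ++ [seq 'i *: delta_mx ij.1 ij.2 | ij : 'I_N * 'I_N].
have [q [sq qG qodd]] := sublinear_odd_seq basis spG.
have qle X c : G X c -> q X <= c.
  by move=> GX; apply: le_trans (qG _) (Gle _ _ GX).
have odd1 i j : q (delta_mx i j) + q (- delta_mx i j) <= 0.
  by apply: qodd; rewrite mem_cat; apply/orP; left;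
    apply/mapP; exists (i, j); rewrite ?mem_enum.
have oddi i j : q ('i *: delta_mx i j) + q (- ('i *: delta_mx i j)) <= 0.
  by apply: qodd; rewrite mem_cat; apply/orP; right;
    apply/mapP; exists (i, j); rewrite ?mem_enum.
(* The entries are chosen so that the real part of [tr (D X)] is [q X]: the real part of
   [(a - i b) (x + i y)] is [a x + b y]. The trace pairing transposes the indices. *)
pose D : 'M[R[i]]_N :=
  \matrix_(j, i) ((q (delta_mx i j))%:C - 'i * (q ('i *: delta_mx i j))%:C).
pose qodd_at X := q X + q (- X) <= 0.
have q_sum (I : finType) (F : I -> 'M[R[i]]_N) : (forall k, qodd_at (F k)) ->
    q (\sum_k F k) = \sum_k q (F k) /\ qodd_at (\sum_k F k).
  move=> oF; elim/big_rec2: _ => [|k a X _ [qX oX]].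
    by rewrite /qodd_at oppr0 !sublinear0 // addr0.
  by rewrite -qX; apply: sublinear_oddD => //; apply: oF.
have qoddZ (c : R) X : qodd_at X -> qodd_at (c%:C *: X).
  move=> oX; rewrite /qodd_at -scaleNr -rmorphN !sublinear_oddZ //.
  by rewrite mulNr subrr.
have ReD (z w : R[i]) : complex.Re (z + w) = complex.Re z + complex.Re w.
  by case: z; case: w.
have ReDX X : complex.Re (\tr (D *m X)) = q X.
  pose F (ij : 'I_N * 'I_N) :=
    (complex.Re (X ij.1 ij.2))%:C *: delta_mx ij.1 ij.2 +
    (complex.Im (X ij.1 ij.2))%:C *: ('i *: delta_mx ij.1 ij.2) : 'M[R[i]]_N.
  have XE : X = \sum_ij F ij.
    rewrite {1}[X]matrix_sum_delta pair_big /=; apply: eq_bigr => -[i j] _ /=.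
    rewrite /F scalerA -scalerDl; congr (_ *: _).
    by rewrite {1}[X i j]complexE mulrC.
  have qF ij := sublinear_oddD sq
    (qoddZ (complex.Re (X ij.1 ij.2)) _ (odd1 ij.1 ij.2))
    (qoddZ (complex.Im (X ij.1 ij.2)) _ (oddi ij.1 ij.2)).
  rewrite [in RHS]XE (q_sum _ _ (fun ij => (qF ij).2)).1.
  have -> : \tr (D *m X) = \sum_(ij : 'I_N * 'I_N) D ij.2 ij.1 * X ij.1 ij.2.
    rewrite /mxtrace; under eq_bigr => k _ do rewrite mxE.
    by rewrite exchange_big /= pair_big.
  rewrite (big_morph _ ReD (erefl : complex.Re 0 = 0)).
  apply: eq_bigr => -[i j] _ /=.
  rewrite (qF (i, j)).1 /=.
  rewrite !sublinear_oddZ // mxE; case: (X i j) => x y /=; ring.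
(* For Hermitian [X], replacing [D] by its adjoint conjugates the trace, so averaging the two leaves
   the real part. *)
have trC X : X \is hermsymmx -> \tr (herm D *m X) = (q X)%:C.
  move=> /hermsymmxP hX; rewrite -scalemxAl mxtraceZ mulmxDl mxtraceD.
  rewrite (mxtrace_mulC (D^t*)) -{2}hX -adjmxM adjmx_tr.
  rewrite -ReDX; case: (\tr _) => x y /=.
  rewrite /Num.conj /=; apply/eqP; rewrite eq_complex /= /half; apply/andP.
  split; apply/eqP; last ring.
  by field.
(* On [K], the choice [Y = X] with [c = 0] gives [q X <= 0]. *)
exists (herm D); last first.
  move=> X KX; rewrite trC; last exact: Kherm.
  rewrite lecR; apply: qle; exists X; first exact: KX.
  by rewrite (herm_id _ (Kherm _ KX)) rmorph0 add0r subrr; apply: psdmx0.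
have herm1 : (1%:M : 'M[R[i]]_N) \is hermsymmx by case: (psdmx1 R N).
split; last first.
  (* The trace is [q 1], which equals [1] because [q 1 <= 1] and [q (- 1) <= - 1], both with
     [Y = 0]. *)
  rewrite -(mulmx1 (herm D)) (trC _ herm1); congr _%:C; apply/le_anti/andP; split.
    apply: qle; exists 0; first exact: K0.
    by rewrite (herm_id _ herm1) rmorph1 addr0 subrr; apply: psdmx0.
  rewrite -lerN2; apply: le_trans (_ : q (- 1%:M) <= _).
    have := sq.1 1%:M (- 1%:M); rewrite subrr sublinear0 //; lra.
  apply: qle; exists 0; first exact: K0.
  rewrite (herm_id _ (hermsymmxN herm1)) rmorphN rmorph1 raddfN addr0 subrr.
  exact: psdmx0.
(* The form at [x] equals [- q (- X)], and [q (- X) <= 0] because [X] is psd. *)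
split; [exact: herm_herm|move=> x; pose X := x *m x^t*].
have hX : X \is hermsymmx by apply/hermsymmxP; rewrite adjmxM trmxCK.
have pX : psdmx X.
  by have := psdmx_congr (x^t*) (psdmx1 R 1); rewrite trmxCK mulmx1.
rewrite -trace_mx11 -mulmxA mxtrace_mulC -mulmxA.
have -> : \tr (herm D *m (x *m x^t*)) = - (q (- X))%:C.
  by rewrite -(trC _ (hermsymmxN hX)) mulmxN raddfN opprK.
rewrite -rmorphN lecR oppr_ge0; apply: qle; exists 0; first exact: K0.
by rewrite (herm_id _ (hermsymmxN hX)) rmorph0 !add0r opprK.
Qed.
End LambdaMin.

(** Removes an error linear in a small parameter; the restriction [e <= 1] lets quadratic errors be
    absorbed into linear ones. *)
Lemma ler_addMgt0 (F : numFieldType) (x y c : F) : 0 <= c ->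
  (forall e, 0 < e -> e <= 1 -> x <= y + e * c) -> x <= y.
Proof.
move=> c0 xy; apply/ler_addgt0Pr => e e0.
have d0 : 0 < c + 1 + e by rewrite addr_gt0 // ltr_wpDl.
(* This parameter is at most [1], and its product with [c] is at most [e]. *)
apply: le_trans (xy (e / (c + 1 + e)) _ _) _.
- by rewrite divr_gt0.
- by rewrite ler_pdivrMr // mul1r lerDr addr_ge0.
rewrite lerD2l -mulrA ler_piMr ?(ltW e0) // mulrC ler_pdivrMr // mul1r.
by rewrite -addrA lerDl addr_ge0 // ltW.
Qed.

(** * Variational formula for the trace of the square root *)

Section Fidelity.
(** In the application, [S = C^(1/2)], [B = \sum_i A_i C A_i] and [G = E_C^(1/2)]. *)
Variables (R : realType) (N : nat) (S B G : 'M[R[i]]_N).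
Hypotheses (pS : psdmx S) (pB : psdmx B) (pG : psdmx G).
Hypothesis GG : G *m G = S *m B *m S.

Let trGG (J : 'M[R[i]]_N) : \tr (J *m (G *m G)) = \tr (S *m J *m S *m B).
Proof.
by rewrite GG mulmxA mxtrace_mulC !mulmxA.
Qed.

(** With [J = Q^-1] and [M = S J S], the gap is [(1 - M W) W^-1 (1 - W M) + e S J^2 S]. *)
Lemma psdmx_inv_compress (W Q : 'M[R[i]]_N) (e : R[i]) : posdefmx W -> 0 < e ->
  Q = S *m W *m S + e%:M ->
  posdefmx Q /\ psdmx (invmx W - S *m invmx Q *m S).
Proof.
move=> pW e0 QE; have pP : psdmx (S *m W *m S).
  by have := psdmx_congr S pW.1; rewrite psdmx_adj.
have pQ : posdefmx Q by rewrite QE addrC; apply/posdefmxDl/pP/posdefmx_scalar.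
split; first exact: pQ.
have pJ := psdmx_inv pQ; set J := invmx Q in pJ *.
have JQJ : J *m (S *m W *m S) *m J = J - e *: (J *m J).
  have -> : S *m W *m S = Q - e%:M by rewrite QE addrK.
  rewrite mulmxBr mulmxBl -(mulmxA J Q J) (mulmxV pQ.2) mulmx1.
  by rewrite mul_mx_scalar -scalemxAl.
pose M := S *m J *m S.
have pM : psdmx M by have := psdmx_congr S pJ; rewrite psdmx_adj.
have := psdmxD (psdmx_congr (1%:M - W *m M) (psdmx_inv pW))
               (psdmxZ (ltW e0) (psdmx_congr (J *m S) (psdmx1 R N))).
congr psdmx; rewrite adjmxM mulmx1 (psdmx_adj pS) (psdmx_adj pJ).
rewrite adjmxD adjmx_scalar conjC1 linearN map_mxN /= adjmxM.
rewrite (psdmx_adj pW.1) (psdmx_adj pM).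
have -> : (1%:M - M *m W) *m invmx W *m (1%:M - W *m M)
        = invmx W - M - M + S *m (J *m (S *m W *m S) *m J) *m S.
  rewrite mulmxBl mul1mx -(mulmxA M) mulmxV ?pW.2 // mulmx1 mulmxBr mulmx1.
  rewrite mulmxBl !(mulmxA (invmx W)) mulVmx ?pW.2 // mul1mx opprB addrA.
  by rewrite addrAC -!addrA; congr (_ + (_ + (_ + _))); rewrite /M !mulmxA.
rewrite JQJ mulmxBr mulmxBl -/M -scalemxAr -scalemxAl !mulmxA.
by rewrite addrA !subrK.
Qed.

(* [S] may be singular; with [Q = S W S + e], [psdmx_inv_compress] reduces to
   [tr ((Q - G) Q^-1 (Q - G)) >= 0]. *)
Lemma fidelity_lower (W : 'M[R[i]]_N) : posdefmx W ->
  2 * \tr G <= \tr (S *m S *m W) + \tr (invmx W *m B).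
Proof.
(* The error [e N] is the trace of the shift in [Q]. *)
move=> pW; apply: (@ler_addMgt0 _ _ _ N%:R) => // e e0 _.
have [Q QE] : exists Q, Q = S *m W *m S + e%:M by exists (S *m W *m S + e%:M).
have [pQ gap] := psdmx_inv_compress pW e0 QE.
have pJ := psdmx_inv pQ; set J := invmx Q in pJ gap.
(* Pairing the gap with [B] gives [tr (J G^2) <= tr (W^-1 B)]. *)
have := psdmx_tr_mul_ge0 gap pB; rewrite mulmxBl linearB /= subr_ge0 -trGG.
move=> le1; have := psdmx_tr_ge0 (psdmx_congr (Q - G) pJ).
rewrite adjmxD linearN map_mxN /= (psdmx_adj pQ.1) (psdmx_adj pG).
have -> : (Q - G) *m J *m (Q - G) = Q - G - G + G *m J *m G.
  rewrite mulmxBl (mulmxV pQ.2) mulmxBl mul1mx mulmxBr -(mulmxA G J Q).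
  by rewrite (mulVmx pQ.2) mulmx1 opprB addrA addrAC.
have -> : \tr (Q - G - G + G *m J *m G)
        = \tr Q - \tr G - \tr G + \tr (J *m (G *m G)).
  by rewrite mxtraceD !raddfB /= -(mulmxA G) (mxtrace_mulC G) -mulmxA.
have -> : \tr Q = \tr (S *m S *m W) + e * N%:R.
  by rewrite QE mxtraceD mxtrace_scalar mulr_natr mxtrace_mulC mulmxA.
move: le1; rewrite -subr_ge0 => le1 le2.
rewrite -subr_ge0; have := addr_ge0 le1 le2; congr (0 <= _); ring.
Qed.

(* [W] is the formal minimizer [S^-1 G S^-1], with [d] and [e] added to make
   [S] and [G] invertible. *)
Lemma fidelity_upper (x : R[i]) :
  (forall W, posdefmx W -> x <= \tr (S *m S *m W) + \tr (invmx W *m B)) ->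
  x <= 2 * \tr G.
Proof.
move=> xle; apply: (@ler_addMgt0 _ _ _ N%:R) => // e e0 _.
have pE : posdefmx (G + e%:M) by rewrite addrC; apply/posdefmxDl/pG/posdefmx_scalar.
have pJ := psdmx_inv pE.
have [J JE] : exists J, J = invmx (G + e%:M) by exists (invmx (G + e%:M)).
rewrite -JE in pJ.
have EJ : (G + e%:M) *m J = 1%:M by rewrite JE mulmxV ?pE.2.
have JEE : J *m (G + e%:M) = 1%:M by rewrite JE mulVmx ?pE.2.
have pGG : psdmx (G *m G).
  by have := psdmx_congr G (psdmx1 R N); rewrite mulmx1 (psdmx_adj pG).
(* Since [J (G + e) = 1], the two sides differ by [e tr (J G)]. *)
have JGG : \tr (J *m (G *m G)) <= \tr G.
  have := psdmx_tr_mul_ge0 pJ pG; rewrite -(subr_ge0 (\tr (J *m (G *m G)))).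
  have -> : \tr G - \tr (J *m (G *m G)) = e * \tr (J *m G).
    rewrite -{1}(mul1mx G) -JEE -mulmxA mulmxDl mulmxDr mxtraceD mul_scalar_mx.
    by rewrite -scalemxAr mxtraceZ addrAC subrr add0r.
  by move=> h; rewrite mulr_ge0 // ltW.
have JGG0 := psdmx_tr_mul_ge0 pJ pGG; have JB0 := psdmx_tr_mul_ge0 pJ pB.
(* With [e] fixed, [d] tends to [0]. The constant collects the terms in [d] of [le2], with [d^2]
   bounded by [d]. *)
apply: (@ler_addMgt0 _ _ _ (\tr (J *m (G *m G)) + 2 * \tr (J *m B))).
  by rewrite addr_ge0 // mulr_ge0.
move=> d d0 d1.
have [D DE] : exists D, D = S + d%:M by exists (S + d%:M).
have pD : posdefmx D by rewrite DE addrC; apply/posdefmxDl/pS/posdefmx_scalar.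
have pT := psdmx_inv pD.
have [T TE] : exists T, T = invmx D by exists (invmx D).
rewrite -TE in pT.
have DT : D *m T = 1%:M by rewrite TE mulmxV ?pD.2.
have TD : T *m D = 1%:M by rewrite TE mulVmx ?pD.2.
have [_ uT] := mulmx1_unit DT.
have pW : posdefmx (T *m (G + e%:M) *m T).
  by have := posdefmx_congr pE uT; rewrite (psdmx_adj pT).
have WE : invmx (T *m (G + e%:M) *m T) = D *m J *m D.
  rewrite -[RHS](mulKmx pW.2) -!mulmxA (mulmxA T D) TD mul1mx.
  by rewrite (mulmxA (G + e%:M)) EJ mul1mx TD mulmx1.
apply: le_trans (xle _ pW) _; rewrite WE.
(* [D^2 - S^2 = 2 d S + d^2] is psd, hence [T S^2 T <= 1]; this is paired with [G + e]. *)
have le1 : \tr (S *m S *m (T *m (G + e%:M) *m T)) <= \tr G + e * N%:R.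
  have gap : psdmx (1%:M - T *m (S *m S) *m T).
    have pSS : psdmx (d *: S + d *: S + (d * d)%:M).
      have pdS := psdmxZ (ltW d0) pS; apply/psdmxD/psdmx_scalar.
        exact: psdmxD.
      by rewrite mulr_ge0 // ltW.
    have := psdmx_congr T pSS; rewrite (psdmx_adj pT); congr psdmx.
    have -> : d *: S + d *: S + (d * d)%:M = D *m D - S *m S.
      rewrite DE mulmxDl !mulmxDr mul_scalar_mx mul_mx_scalar -scalar_mxM.
      by rewrite -!addrA [RHS]addrC !addrA subrK.
    by rewrite mulmxBr mulmxBl (mulmxA T D) TD mul1mx DT.
  have := psdmx_tr_mul_ge0 gap pE.1; rewrite mulmxBl mul1mx linearB /= subr_ge0.
  rewrite mxtraceD mxtrace_scalar mulr_natr.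
  rewrite -mulmxA -(mulmxA T) mxtrace_mulC (mulmxA _ T (_ *m T)).
  by rewrite mxtrace_mulC -(mulmxA (S *m S)).
have le2 : \tr (D *m J *m D *m B) <=
    (1 + d) * \tr (J *m (G *m G)) + (d + d * d) * \tr (J *m B).
  have gap : psdmx ((1 + d) *: (G *m G) + (d + d * d) *: B - D *m B *m D).
    (* The cross terms are controlled by [(S - 1) B (S - 1) >= 0]. *)
    have pI : psdmx (d *: ((S - 1%:M) *m B *m (S - 1%:M))).
      apply: psdmxZ; first exact: ltW.
      have := psdmx_congr (S - 1%:M) pB.
      by rewrite adjmxD linearN map_mxN /= (psdmx_adj pS) adjmx_scalar conjC1.
    move: pI; congr psdmx; rewrite DE GG.
    rewrite mulmxBl mulmxBr mul1mx mulmx1 mulmxBl.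
    rewrite mulmxDl mulmxDr mul_scalar_mx mul_mx_scalar mulmxDl -scalemxAl.
    move: (S *m B *m S) (S *m B) (B *m S) => X Y U.
    by apply/matrixP => i j; rewrite !mxE; ring.
  have := psdmx_tr_mul_ge0 pJ gap.
  rewrite mulmxBr mulmxDr linearB linearD /= -!scalemxAr !mxtraceZ subr_ge0.
  by rewrite (mulmxA J) (mxtrace_mulC _ D) (mulmxA J) !(mulmxA D).
rewrite -subr_ge0 in le1; rewrite -subr_ge0 in le2; rewrite -subr_ge0 in JGG.
have d2 : 0 <= d * (1 - d) * \tr (J *m B).
  by rewrite !mulr_ge0 ?subr_ge0 // ltW.
rewrite -subr_ge0; have := addr_ge0 (addr_ge0 le1 le2) (addr_ge0 JGG d2).
congr (0 <= _); ring.
Qed.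

End Fidelity.

(** * Duality *)

Section Duality.
Variables (R : realType) (N n : nat).
Variables (A0 : 'M[R[i]]_N) (A : 'I_n -> 'M[R[i]]_N).
Hypotheses (A0_herm : A0 \is hermsymmx) (A_herm : forall i, A i \is hermsymmx).
Local Notation Phi := (primal_mx A0 A).

Lemma invmxN (W : 'M[R[i]]_N) : W \in unitmx -> invmx (- W) = - invmx W.
Proof.
move=> uW; rewrite -scaleN1r invmxZ; first by rewrite invrN1 scaleN1r.
by rewrite unitmxZ // unitrN1.
Qed.

Lemma negdefmxN (W : 'M[R[i]]_N) : posdefmx W -> negdefmx (- W).
Proof. by move=> pW; apply/negdefmxE; rewrite opprK. Qed.

(** The adjoints make each term a congruence, which preserves psd matrices; for Hermitian [A i] this
    is the map [\sum_i A_i X A_i] of the primal matrix. *)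
Definition sum_congr (X : 'M[R[i]]_N) := \sum_(i < n) (A i)^t* *m X *m A i.

Lemma sum_congrD X Y : sum_congr (X + Y) = sum_congr X + sum_congr Y.
Proof.
by rewrite -big_split; apply: eq_bigr => i _; rewrite mulmxDr mulmxDl.
Qed.

Lemma sum_congrZ c X : sum_congr (c *: X) = c *: sum_congr X.
Proof.
by rewrite scaler_sumr; apply: eq_bigr => i _; rewrite -scalemxAr -scalemxAl.
Qed.

Lemma sum_congr_psd X : psdmx X -> psdmx (sum_congr X).
Proof. by move=> pX; apply: psdmx_sum => i; apply: psdmx_congr. Qed.

Lemma primal_mx_opp (W : 'M[R[i]]_N) : W \in unitmx ->
  Phi (- W) = A0 - W - sum_congr (invmx W).
Proof.
move=> uW; rewrite /primal_mx invmxN //; congr (_ + _).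
rewrite -sumrN; apply: eq_bigr => i _.
by rewrite (hermsymmxP _ (A_herm i)) mulmxN mulNmx.
Qed.

Lemma primal_mx_herm (Z : 'M[R[i]]_N) : negdefmx Z -> Phi Z \is hermsymmx.
Proof.
move=> /negdefmxE pZ; rewrite -(opprK Z) (primal_mx_opp pZ.2).
apply: hermsymmxD; first exact/hermsymmxD/hermsymmxN/pZ.1.1.
exact/hermsymmxN/(sum_congr_psd _).1/psdmx_inv.
Qed.

(** The convexity gap of the inverse is carried over by the positive map [sum_congr]; the affine
    part cancels because [a + b = 1]. *)
Lemma primal_mx_concave (a b : R[i]) (Z Y : 'M[R[i]]_N) :
  0 < a -> 0 < b -> a + b = 1 -> negdefmx Z -> negdefmx Y ->
  negdefmx (a *: Z + b *: Y) /\
  psdmx (Phi (a *: Z + b *: Y) - (a *: Phi Z + b *: Phi Y)).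
Proof.
move=> a0 b0 ab /negdefmxE pZ /negdefmxE pY.
rewrite -(opprK Z) -(opprK Y); move: (- Z) (- Y) pZ pY => {Z Y} W V pW pV.
have pS : posdefmx (a *: W + b *: V).
  by apply: posdefmxDl; [apply: posdefmxZ|apply: psdmxZ pV.1; apply: ltW].
rewrite !scalerN -opprD; split; first exact: negdefmxN.
have gap := psdmx_inv_convex a0 b0 ab pW pV.
rewrite !primal_mx_opp; [|exact: pV.2|exact: pW.2|exact: pS.2].
have := sum_congr_psd gap; congr psdmx.
rewrite -scaleN1r !sum_congrD !sum_congrZ scaleN1r.
move: (sum_congr _) (sum_congr _) (sum_congr _) => X Y U.
apply/matrixP => i j; rewrite !mxE.
rewrite -[A0 i j in X in X - _ - _](mul1r) -ab; ring.
Qed.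

Lemma mxtrace_mul_sumr (X : 'M[R[i]]_N) (F : 'I_n -> 'M[R[i]]_N) :
  \tr (X *m \sum_i F i) = \sum_i \tr (X *m F i).
Proof. by rewrite mulmx_sumr raddf_sum. Qed.

(** The map [\sum_i A_i X A_i] is self-adjoint for the trace pairing, by cyclicity. *)
Lemma tr_mul_sum_congr (C X : 'M[R[i]]_N) :
  \tr (C *m sum_congr X) = \tr (X *m \sum_(i < n) A i *m C *m A i).
Proof.
apply: etrans (mxtrace_mul_sumr _ _) (etrans _ (esym (mxtrace_mul_sumr _ _))).
apply: eq_bigr => i _; rewrite (hermsymmxP _ (A_herm i)).
have -> : C *m (A i *m X *m A i) = (C *m A i) *m (X *m A i).
  by rewrite !mulmxA.
by rewrite mxtrace_mulC -2!mulmxA (mulmxA (A i)).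
Qed.

Lemma tr_primal_mx (C W : 'M[R[i]]_N) : W \in unitmx ->
  \tr (C *m Phi (- W)) =
  \tr (A0 *m C) - (\tr (C *m W) + \tr (invmx W *m \sum_(i < n) A i *m C *m A i)).
Proof.
move=> uW; rewrite (primal_mx_opp uW) 2!mulmxBr.
rewrite 2!linearB /= (mxtrace_mulC C A0) opprD addrA.
exact: (congr1 (fun x => _ - x) (tr_mul_sum_congr C (invmx W))).
Qed.

Lemma dual_sqrtE (C : 'M[R[i]]_N) : psdmx C ->
  let S := psd_sqrtmx C in let G := psd_sqrtmx (Emx A C) in
  [/\ psdmx S, S *m S = C, psdmx G,
      G *m G = S *m (\sum_(i < n) A i *m C *m A i) *m S
    & psdmx (\sum_(i < n) A i *m C *m A i)].
Proof.
move=> pC; have [pS SS] := psd_sqrtmxP pC.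
have [pG GG] := psd_sqrtmxP (Emx_psd A_herm pC).
split; [exact: pS|exact: SS|exact: pG|exact: GG|apply: psdmx_sum => i].
by have := psdmx_congr (A i) pC; rewrite (hermsymmxP _ (A_herm i)).
Qed.

Lemma tr_primal_le_dual (C Z : 'M[R[i]]_N) : psdmx C -> negdefmx Z ->
  \tr (C *m Phi Z) <= dual_obj A0 A C.
Proof.
move=> pC /negdefmxE pW; have [pS SS pG GG pB] := dual_sqrtE pC.
rewrite -(opprK Z) (tr_primal_mx _ pW.2) lerD2l lerN2.
by have := fidelity_lower pS pB pG GG pW; rewrite SS.
Qed.

Lemma dual_le_sup_tr_primal (C : 'M[R[i]]_N) (x : R[i]) : psdmx C ->
  (forall Z, negdefmx Z -> \tr (C *m Phi Z) <= x) -> dual_obj A0 A C <= x.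
Proof.
move=> pC Cx; have [pS SS pG GG pB] := dual_sqrtE pC.
rewrite /dual_obj lerBlDl -lerBlDr.
apply: (fidelity_upper pS pB pG GG) => W pW.
have := Cx _ (negdefmxN pW); rewrite (tr_primal_mx _ pW.2) SS.
by rewrite lerBlDl -lerBlDr.
Qed.

(** Weak duality: pair the psd matrix [Phi Z - lambda_min (Phi Z)] with [C], which has trace one. *)
Lemma lambda_min_le_dual (C Z : 'M[R[i]]_N) : (0 < N)%N ->
  density C -> negdefmx Z -> (lambda_min (Phi Z))%:C <= dual_obj A0 A C.
Proof.
move=> N0 [pC C1] nZ; apply: le_trans (tr_primal_le_dual pC nZ).
have := psdmx_tr_mul_ge0 pC (psdmx_lambda_min N0 (primal_mx_herm nZ)).
by rewrite mulmxBr linearB /= mul_mx_scalar mxtraceZ C1 mulr1 subr_ge0.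
Qed.

Lemma density_ex : (0 < N)%N -> exists C : 'M[R[i]]_N, density C.
Proof.
move=> N0; exists (N%:R^-1)%:M; split.
  by apply: psdmx_scalar; rewrite invr_ge0.
by rewrite mxtrace_scalar -[LHS]mulr_natr mulVf // pnatr_eq0 -lt0n.
Qed.

(** Taking all Hermitian matrices dominated by a multiple of [Phi Z - s] turns concavity into
    closure under addition; [t = 0] puts [0] in the cone. *)
Definition primal_cone (s : R) : set 'M[R[i]]_N := [set X |
  X \is hermsymmx /\ exists t Z, [/\ 0 <= t :> R, negdefmx Z
    & psdmx (t%:C *: (Phi Z - s%:C%:M) - X)]].

Lemma primal_coneD (s : R) (X Y : 'M[R[i]]_N) :
  primal_cone s X -> primal_cone s Y -> primal_cone s (X + Y).
Proof.
move=> [hX [t [Z [t0 nZ pX]]]] [hY [u [V [u0 nV pY]]]].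
split; first exact: (hermsymmxD hX hY).
have pXY := psdmxD pX pY.
move: t0; rewrite le0r => /orP[/eqP t0|t0].
  exists u, V; split; [exact: u0|exact: nV|]; move: pXY; congr psdmx.
  by rewrite t0 scale0r sub0r addrCA opprD.
move: u0; rewrite le0r => /orP[/eqP u0|u0].
  exists t, Z; split; [exact: ltW|exact: nZ|]; move: pXY; congr psdmx.
  by rewrite u0 scale0r sub0r opprD addrA.
have tu0 : 0 < t + u by apply: addr_gt0.
(* With these weights [(t + u) (a Phi Z + b Phi V) = t Phi Z + u Phi V], which concavity bounds by
   [t + u] times one value of [Phi]. *)
pose a := t / (t + u); pose b := u / (t + u).
have [|||nW pW] := @primal_mx_concave a%:C b%:C Z V _ _ _ nZ nV.
- by rewrite ltcR divr_gt0.
- by rewrite ltcR divr_gt0.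
- by rewrite -rmorphD -mulrDl mulfV // gt_eqF.
exists (t + u), (a%:C *: Z + b%:C *: V); split; [exact: ltW|exact: nW|].
have := psdmxD (psdmxZ _ pW) pXY => /(_ (t + u)%:C); rewrite lecR => /(_ (ltW tu0)).
have tuC : t%:C + u%:C != 0 by rewrite -rmorphD fmorph_eq0 gt_eqF.
congr psdmx; move: (Phi _) (Phi _) (Phi _) => P1 P2 P3; move: s%:C%:M => M.
rewrite /a /b !rmorphM !fmorphV rmorphD.
by apply/matrixP => i j; rewrite !mxE; field.
Qed.

Lemma primal_coneZ (s c : R) (X : 'M[R[i]]_N) :
  0 < c -> primal_cone s X -> primal_cone s (c%:C *: X).
Proof.
move=> c0 [/hermsymmxP hX [t [Z [t0 nZ pX]]]]; split.
  by apply/hermsymmxP; rewrite adjmxZ conjC_real hX.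
exists (c * t), Z; split; [by rewrite mulr_ge0 // ltW|exact: nZ|].
have := @psdmxZ _ _ c%:C _ _ pX; rewrite lecR => /(_ (ltW c0)).
by rewrite scalerBr scalerA -rmorphM.
Qed.

(** If [X >= c], then [t (Phi Z - s) >= c]. For [t > 0] this gives
    [s + c / t <= lambda_min (Phi Z) <= s]; for [t = 0] the trace gives [- c N >= 0]. *)
Lemma primal_cone_npd (s : R) (X : 'M[R[i]]_N) (c : R) : (0 < N)%N ->
  (forall Z, negdefmx Z -> lambda_min (Phi Z) <= s) ->
  primal_cone s X -> psdmx (X - c%:C%:M) -> c <= 0.
Proof.
move=> N0 lmin [_ [t [Z [t0 nZ pX]]]] pXc.
have := psdmxD pX pXc; rewrite addrA subrK => pZ.
move: t0; rewrite le0r => /orP[/eqP t0|t0].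
  have := psdmx_tr_ge0 pZ; rewrite t0 scale0r sub0r raddfN /= mxtrace_scalar.
  by rewrite oppr_ge0 pmulrn_lle0 // lecR.
have : psdmx (Phi Z - (s + c / t)%:C%:M).
  have := @psdmxZ _ _ (t^-1)%:C _ _ pZ.
  rewrite lecR invr_ge0 => /(_ (ltW t0)); congr psdmx.
  rewrite scalerBr scalerA -rmorphM mulVf ?gt_eqF // scale1r.
  by rewrite scale_scalar_mx -rmorphM rmorphD raddfD opprD addrA mulrC.
move=> /(le_lambda_min N0) /le_trans/(_ (lmin _ nZ)).
by rewrite gerDl pmulr_lle0 // invr_gt0.
Qed.

Lemma dual_attained (s : R) : (0 < N)%N ->
  (forall Z, negdefmx Z -> lambda_min (Phi Z) <= s) ->
  exists2 C : 'M[R[i]]_N, density C & dual_obj A0 A C <= s%:C.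
Proof.
move=> N0 lmin; have nZ1 : negdefmx (- (1%:M : 'M[R[i]]_N)).
  exact/negdefmxN/posdefmx_scalar.
have [||||| C dC CK] := @density_separation R N (primal_cone s) N0.
- split; first exact: (psdmx0 _ _).1.
  exists 0, (- 1%:M); split; [exact: lexx|exact: nZ1|]; rewrite scale0r subrr.
  exact: psdmx0.
- exact: primal_coneD.
- exact: primal_coneZ.
- by move=> X [].
- by move=> X c; apply: primal_cone_npd.
exists C => //; apply: dual_le_sup_tr_primal => [|Z nZ]; first exact: dC.1.
(* The matrix [Phi Z - s] lies in the cone with [t = 1], and [C] has trace one, so
   [tr (C (Phi Z)) <= s]. *)
have /CK : primal_cone s (Phi Z - s%:C%:M).
  split; first exact/hermsymmxD/hermsymmxN/hermsymmx_real_scalar/primal_mx_herm.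
  exists 1, Z; split; [exact: ler01|exact: nZ|]; rewrite scale1r subrr.
  exact: psdmx0.
by rewrite mulmxBr linearB /= mul_mx_scalar mxtraceZ dC.2 mulr1 subr_le0.
Qed.

End Duality.

Theorem proposition3p5 (R : realType) (N n : nat) (N_gt0 : (0 < N)%N)
    (A0 : 'M[R[i]]_N) (A : 'I_n -> 'M[R[i]]_N)
    (A0_herm : A0 \is hermsymmx) (A_herm : forall i, A i \is hermsymmx) :
  exists m : R,
    [/\ ereal_sup [set (lambda_min (primal_mx A0 A Z))%:E | Z in @negdefmx R N]
          = m%:E,
        exists2 C : 'M[R[i]]_N, density C & dual_obj A0 A C = m%:C
      & forall C : 'M[R[i]]_N, density C -> m%:C <= dual_obj A0 A C].
Proof.
(* [L] is nonempty, and bounded above by weak duality, so its real supremum is also the extended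
   one. *)
pose L : set R := [set lambda_min (primal_mx A0 A Z) | Z in @negdefmx R N].
have L0 : L !=set0.
  by exists (lambda_min (primal_mx A0 A (- 1%:M))), (- 1%:M) => //;
    apply/negdefmxN/posdefmx_scalar.
have L_le_dual C : density C ->
    (complex.Re (dual_obj A0 A C))%:C = dual_obj A0 A C /\
    forall a, L a -> a <= complex.Re (dual_obj A0 A C).
  move=> dC; have weak Z : negdefmx Z -> _ :=
    lambda_min_le_dual A0_herm A_herm N_gt0 dC.
  (* A complex number above a real one in the partial order of [R[i]] is real. *)
  have dreal : (complex.Re (dual_obj A0 A C))%:C = dual_obj A0 A C.
    have [_ [Z nZ _]] := L0; have := weak Z nZ.
    by case: (dual_obj _ _ _) => x y; rewrite lecE /= => /andP[/eqP-> _].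
  by split=> // a [Z /weak le_d <-]; rewrite -lecR dreal.
have [C0 dC0] := density_ex R N_gt0.
have ubL : has_ubound L.
  by exists (complex.Re (dual_obj A0 A C0)); apply: (L_le_dual _ dC0).2.
have supL C : density C -> (sup L)%:C <= dual_obj A0 A C.
  move=> /L_le_dual[<- Lle]; rewrite lecR; exact: ge_sup.
exists (sup L); split=> //.
  by rewrite -ereal_sup_EFin // image_comp.
have [|C dC Cle] := @dual_attained R N n A0 A A0_herm A_herm (sup L) N_gt0.
  by move=> Z nZ; apply: ub_le_sup => //; exists Z.
by exists C => //; apply/le_anti; rewrite Cle supL.
Qed.
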